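(* There exist universal numerical constants $c>0$ and $\hat c>0$ such that the following holds. Let $M\in\mathbb{R}^{n\times n}$ be a positive definite matrix, let $U_0\in\mathbb{R}^{n\times n}$ be a positive definite matrix, and define $$\alpha = \left(\frac{\max\left(\|U_0\|_2,\sqrt{\|M\|_2}\right)}{\min\left(\sigma_{\min}(U_0),\sqrt{\sigma_{\min}(M)}\right)}\right)^3,\qquad \beta=\min\left(\sigma_{\min}(U_0),\sqrt{\sigma_{\min}(M)}\right).$$ Let the step size $\eta>0$ satisfy $\eta<\frac{c}{\alpha\beta^2}$, let $T\ge1$ be the number of iterations, and let $\Delta_0,\dots,\Delta_{T-1}\in\mathbb{R}^{n\times n}$ be arbitrary error matrices with $\|\Delta_t\|_2<\frac{1}{300}\,\eta\,\sigma_{\min}(M)\,\beta$ for every $t$. Let $$U_{t+1}=U_t-\eta(U_t^2-M)U_t-\eta U_t(U_t^2-M)+\Delta_t,\qquad t=0,\dots,T-1.$$ Then for every $t\in\{0,1,\dots,T-1\}$, $U_t$ is a positive definite matrix and $$\|M-U_t^2\|_F\le \exp\left(-\hat c\,\eta\,\beta^2 t\right)\|M-U_0^2\|_F+4\max\left(\|U_0\|_2,\sqrt{3\|M\|_2}\right)\sum_{s=0}^{t-1}e^{-\hat c\,\eta\,\beta^2(t-s-1)}\|\Delta_s\|_F.$$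
   Context: $\|\cdot\|_2$ is the operator (spectral) norm, $\|\cdot\|_F$ the Frobenius norm, and $\sigma_{\min}(\cdot)$ the smallest singular value. Universal constants do not depend on $n$, $M$, $U_0$, $\eta$, $T$ or the errors. The iteration is gradient descent for computing the square root of $M$ by minimizing $\|M-U^2\|_F^2$ over $U\succeq 0$, and the matrix $\Delta_t$ is the (small, arbitrary) error incurred in the $t$-th gradient step.
   Formalization: The errors Δ_t with t+1<T are assumed symmetric (Δ_{T-1} stays arbitrary): for M=U_0=I and a small nonzero skew-symmetric Δ_0, U_1=I+Δ_0 is not symmetric, so the claim with arbitrary errors fails. Also n≥1. *)

(* Defs.v *)
From HB Require Import structures.
From mathcomp Require Import all_boot all_order all_algebra.
From mathcomp Require Import all_classical all_reals all_analysis.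
Set Implicit Arguments.
Unset Strict Implicit.
Unset Printing Implicit Defensive.
Import Order.TTheory GRing.Theory Num.Theory.
Local Open Scope classical_set_scope.
Local Open Scope ring_scope.

(* On column vectors this is the Euclidean norm. The norm `|A| that
   MathComp-Analysis puts on matrices is the maximum of the entries. *)
Definition frobenius_norm (R : realType) (m n : nat) (A : 'M[R]_(m, n)) : R :=
  Num.sqrt (\sum_i \sum_j A i j ^+ 2).

Definition spectral_norm (R : realType) (m n : nat) (A : 'M[R]_(m, n)) : R :=
  sup [set frobenius_norm (A *m x) |
        x in [set x : 'cV[R]_n | frobenius_norm x <= 1]].

Definition singular_value (R : realType) (n : nat) (A : 'M[R]_n) : set R :=
  [set s | 0 <= s /\ eigenvalue (A^T *m A) (s ^+ 2)].

(* For 0 < n the set is finite and nonempty, so the infimum is a minimum. *)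
Definition sigma_min (R : realType) (n : nat) (A : 'M[R]_n) : R :=
  inf (singular_value A).

Definition posdef (R : realType) (n : nat) (A : 'M[R]_n) : Prop :=
  A^T = A /\ forall x : 'cV[R]_n, x != 0 -> 0 < (x^T *m A *m x) 0 0.

Definition alpha (R : realType) (n : nat) (M U0 : 'M[R]_n) : R :=
  (Num.max (spectral_norm U0) (Num.sqrt (spectral_norm M)) /
   Num.min (sigma_min U0) (Num.sqrt (sigma_min M))) ^+ 3.

Definition beta (R : realType) (n : nat) (M U0 : 'M[R]_n) : R :=
  Num.min (sigma_min U0) (Num.sqrt (sigma_min M)).

(* The gradient step for ||M - U^2||_F^2, without the error term. *)
Definition sqrt_gd_step (R : realType) (n : nat) (M : 'M[R]_n) (eta : R)
    (U : 'M[R]_n) : 'M[R]_n :=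
  U - eta *: ((U *m U - M) *m U) - eta *: (U *m (U *m U - M)).

(* Main.v *)
(* Write [E = U^2 - M], [B = max (|U0|, sqrt (3 |M|))] and [u = beta / 2]. The
   step size makes [eta B^2] small and [eta B |M| <= beta / 50], and under these
   bounds a step, with or without its error, preserves [u <= U <= B] in the
   Loewner order. Since [V = U - eta G] with [G = E U + U E] and
   [<E, U G + G U> = |G|_F^2], the exact step satisfies
   [|V^2 - M|_F^2 <= |E|_F^2 - eta |G|_F^2], the second-order terms costing only
   a fraction of [eta |G|_F^2]; finally [|G|_F >= 2 u |E|_F]. *)
Require Import Defs.
From mathcomp Require Import all_boot all_order all_algebra.
From mathcomp Require Import all_classical all_reals all_analysis.
From mathcomp Require Import ring lra.
Set Implicit Arguments.
Unset Strict Implicit.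
Unset Printing Implicit Defensive.
Import Order.TTheory GRing.Theory Num.Theory.
Local Open Scope ring_scope.

(** * The Frobenius inner product *)

(** Rectangular shapes are allowed so that column vectors and square matrices obey the same
    lemmas. *)
Definition dotm (R : realType) (m n : nat) (A B : 'M[R]_(m, n)) : R :=
  \tr (A^T *m B).

Lemma dotmE (R : realType) m n (A B : 'M[R]_(m, n)) :
  dotm A B = \sum_i \sum_j A i j * B i j.
Proof.
rewrite /dotm /mxtrace exchange_big /=; apply: eq_bigr => j _.
by rewrite mxE; apply: eq_bigr => i _; rewrite mxE.
Qed.

Lemma dotmC (R : realType) m n (A B : 'M[R]_(m, n)) : dotm A B = dotm B A.
Proof. by rewrite /dotm -mxtrace_tr trmx_mul trmxK. Qed.

Lemma dotmDr (R : realType) m n (A B C : 'M[R]_(m, n)) :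
  dotm A (B + C) = dotm A B + dotm A C.
Proof. by rewrite /dotm mulmxDr mxtraceD. Qed.

Lemma dotmNr (R : realType) m n (A B : 'M[R]_(m, n)) :
  dotm A (- B) = - dotm A B.
Proof. by rewrite /dotm mulmxN raddfN. Qed.

Lemma dotmZr (R : realType) m n a (A B : 'M[R]_(m, n)) :
  dotm A (a *: B) = a * dotm A B.
Proof. by rewrite /dotm -scalemxAr mxtraceZ. Qed.

Lemma dotmDl (R : realType) m n (A B C : 'M[R]_(m, n)) :
  dotm (A + B) C = dotm A C + dotm B C.
Proof. by rewrite dotmC dotmDr !(dotmC C). Qed.

Lemma dotmNl (R : realType) m n (A B : 'M[R]_(m, n)) :
  dotm (- A) B = - dotm A B.
Proof. by rewrite dotmC dotmNr dotmC. Qed.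

Lemma dotmZl (R : realType) m n a (A B : 'M[R]_(m, n)) :
  dotm (a *: A) B = a * dotm A B.
Proof. by rewrite dotmC dotmZr dotmC. Qed.

Definition dotm_lin (R : realType) := (@dotmDr R, @dotmDl R, @dotmNr R,
  @dotmNl R, @dotmZr R, @dotmZl R).

Lemma dotm_tr (R : realType) m n (A B : 'M[R]_(m, n)) :
  dotm A^T B^T = dotm A B.
Proof. by rewrite dotmC /dotm trmxK mxtrace_mulC. Qed.

Lemma dotm_mull (R : realType) m n p (A : 'M[R]_(m, n)) (B : 'M[R]_(n, p)) C :
  dotm (A *m B) C = dotm B (A^T *m C).
Proof. by rewrite /dotm trmx_mul mulmxA. Qed.

Lemma dotm_mulr (R : realType) m n p (A : 'M[R]_(m, n)) (B : 'M[R]_(n, p)) C :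
  dotm (A *m B) C = dotm A (C *m B^T).
Proof. by rewrite -dotm_tr trmx_mul dotm_mull -dotm_tr trmx_mul !trmxK. Qed.

Lemma dotm_ge0 (R : realType) m n (A : 'M[R]_(m, n)) : 0 <= dotm A A.
Proof.
by rewrite dotmE; do 2!apply: sumr_ge0 => ? _; rewrite -expr2 sqr_ge0.
Qed.

Lemma dotm_eq0 (R : realType) m n (A : 'M[R]_(m, n)) :
  (dotm A A == 0) = (A == 0).
Proof.
apply/eqP/eqP => [|->]; last by rewrite /dotm mulmx0 mxtrace0.
rewrite dotmE => /eqP; rewrite psumr_eq0 => [/allP A0|i _]; last first.
  by apply: sumr_ge0 => j _; rewrite -expr2 sqr_ge0.
apply/matrixP => i j; rewrite mxE; apply/eqP.
have := A0 i (mem_index_enum i); rewrite /= psumr_eq0 => [/allP|k _]; last first.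
  by rewrite -expr2 sqr_ge0.
by move=> /(_ j (mem_index_enum j)) /=; rewrite -expr2 sqrf_eq0.
Qed.

Lemma dotm_gt0 (R : realType) m n (A : 'M[R]_(m, n)) :
  A != 0 -> 0 < dotm A A.
Proof. by rewrite lt_def dotm_eq0 dotm_ge0 andbT. Qed.

Lemma dotm_CauchySchwarz (R : realType) m n (A B : 'M[R]_(m, n)) :
  dotm A B ^+ 2 <= dotm A A * dotm B B.
Proof.
have [->|B0] := eqVneq B 0.
  by rewrite /dotm !mulmx0 !mxtrace0 mulr0 expr0n.
(* The square of this vector is [|B|^2 (|A|^2 |B|^2 - <A, B>^2)]. *)
have := dotm_ge0 (dotm B B *: A - dotm A B *: B).
rewrite !dotm_lin (dotmC B A) => H.
rewrite -subr_ge0 -(pmulr_rge0 _ (dotm_gt0 B0)).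
by apply: le_trans H _; rewrite le_eqVlt; apply/orP; left; apply/eqP; ring.
Qed.

Lemma frobenius_normE (R : realType) m n (A : 'M[R]_(m, n)) :
  frobenius_norm A = Num.sqrt (dotm A A).
Proof. by rewrite dotmE. Qed.

Lemma sqr_frobenius_norm (R : realType) m n (A : 'M[R]_(m, n)) :
  frobenius_norm A ^+ 2 = dotm A A.
Proof. by rewrite frobenius_normE sqr_sqrtr // dotm_ge0. Qed.

Lemma frobenius_norm_ge0 (R : realType) m n (A : 'M[R]_(m, n)) :
  0 <= frobenius_norm A.
Proof. exact: sqrtr_ge0. Qed.

Lemma frobenius_norm_eq0 (R : realType) m n (A : 'M[R]_(m, n)) :
  (frobenius_norm A == 0) = (A == 0).
Proof. by rewrite -sqrf_eq0 sqr_frobenius_norm dotm_eq0. Qed.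

Lemma frobenius_norm0 (R : realType) m n :
  frobenius_norm (0 : 'M[R]_(m, n)) = 0.
Proof. by apply/eqP; rewrite frobenius_norm_eq0. Qed.

Lemma frobenius_normZ (R : realType) m n a (A : 'M[R]_(m, n)) :
  frobenius_norm (a *: A) = `|a| * frobenius_norm A.
Proof.
by rewrite !frobenius_normE !dotm_lin mulrA -expr2 sqrtrM ?sqr_ge0 // sqrtr_sqr.
Qed.

Lemma frobenius_normN (R : realType) m n (A : 'M[R]_(m, n)) :
  frobenius_norm (- A) = frobenius_norm A.
Proof. by rewrite !frobenius_normE !dotm_lin opprK. Qed.

Lemma frobenius_norm_tr (R : realType) m n (A : 'M[R]_(m, n)) :
  frobenius_norm A^T = frobenius_norm A.
Proof. by rewrite !frobenius_normE dotm_tr. Qed.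

Lemma ler_norm_dotm (R : realType) m n (A B : 'M[R]_(m, n)) :
  `|dotm A B| <= frobenius_norm A * frobenius_norm B.
Proof.
rewrite -(@ler_pXn2r _ 2) ?nnegrE ?mulr_ge0 ?frobenius_norm_ge0 //.
by rewrite real_normK ?num_real // exprMn !sqr_frobenius_norm dotm_CauchySchwarz.
Qed.

Lemma ler_dotm (R : realType) m n (A B : 'M[R]_(m, n)) :
  dotm A B <= frobenius_norm A * frobenius_norm B.
Proof. exact: le_trans (ler_norm _) (ler_norm_dotm _ _). Qed.

Lemma ler_frobenius_normD (R : realType) m n (A B : 'M[R]_(m, n)) :
  frobenius_norm (A + B) <= frobenius_norm A + frobenius_norm B.
Proof.
rewrite -(@ler_pXn2r _ 2) ?nnegrE ?addr_ge0 ?frobenius_norm_ge0 //.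
rewrite sqrrD !sqr_frobenius_norm !dotm_lin (dotmC B A).
have := ler_dotm A B; lra.
Qed.

Lemma ler_frobenius_normB (R : realType) m n (A B : 'M[R]_(m, n)) :
  frobenius_norm (A - B) <= frobenius_norm A + frobenius_norm B.
Proof. by rewrite -(frobenius_normN B) ler_frobenius_normD. Qed.

Lemma dotm_col (R : realType) m n (A B : 'M[R]_(m, n)) :
  dotm A B = \sum_j dotm (col j A) (col j B).
Proof.
rewrite dotmE exchange_big; apply: eq_bigr => j _.
by rewrite dotmE; apply: eq_bigr => i _; rewrite big_ord1 !mxE.
Qed.

(** * Bounds on the spectral norm *)

(** Testing on any number of columns lets the bound act directly on Frobenius norms of matrix
    products; by [opnorm_le_cV], single columns suffice when [0 <= a]. *)
Definition opnorm_le (R : realType) (n : nat) (a : R) (A : 'M[R]_n) : Prop :=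
  forall p (X : 'M[R]_(n, p)), frobenius_norm (A *m X) <= a * frobenius_norm X.

Lemma opnorm_leD (R : realType) n (a b : R) (A B : 'M[R]_n) :
  opnorm_le a A -> opnorm_le b B -> opnorm_le (a + b) (A + B).
Proof.
move=> HA HB p X; rewrite mulmxDl mulrDl.
exact: le_trans (ler_frobenius_normD _ _) (lerD (HA _ _) (HB _ _)).
Qed.

Lemma opnorm_leN (R : realType) n (a : R) (A : 'M[R]_n) :
  opnorm_le a A -> opnorm_le a (- A).
Proof. by move=> HA p X; rewrite mulNmx frobenius_normN HA. Qed.

Lemma opnorm_leM (R : realType) n (a b : R) (A B : 'M[R]_n) : 0 <= a ->
  opnorm_le a A -> opnorm_le b B -> opnorm_le (a * b) (A *m B).
Proof.
move=> a0 HA HB p X; rewrite -mulmxA -mulrA.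
exact: le_trans (HA _ _) (ler_wpM2l a0 (HB _ _)).
Qed.

Lemma opnorm_le_mulr (R : realType) n (a : R) (A : 'M[R]_n) p (X : 'M[R]_(p, n)) :
  A^T = A -> opnorm_le a A -> frobenius_norm (X *m A) <= a * frobenius_norm X.
Proof.
by move=> As HA; rewrite -frobenius_norm_tr trmx_mul As -(frobenius_norm_tr X) HA.
Qed.

Lemma opnorm_le_quad (R : realType) n (a : R) (A : 'M[R]_n) p (X : 'M[R]_(n, p)) :
  opnorm_le a A -> `|dotm X (A *m X)| <= a * dotm X X.
Proof.
move=> HA; apply: le_trans (ler_norm_dotm _ _) _.
rewrite -sqr_frobenius_norm expr2 mulrA [leLHS]mulrC.
by rewrite ler_wpM2r ?frobenius_norm_ge0.
Qed.

Lemma opnorm_le_cV (R : realType) n (a : R) (A : 'M[R]_n) : 0 <= a ->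
  (forall x : 'cV[R]_n, frobenius_norm (A *m x) <= a * frobenius_norm x) ->
  opnorm_le a A.
Proof.
move=> a0 HA p X; rewrite -(@ler_pXn2r _ 2) ?nnegrE ?mulr_ge0 ?frobenius_norm_ge0 //.
rewrite exprMn !sqr_frobenius_norm dotm_col (dotm_col X X) mulr_sumr.
apply: ler_sum => j _; rewrite !colE -mulmxA -!sqr_frobenius_norm -exprMn.
by rewrite ler_pXn2r ?nnegrE ?mulr_ge0 ?frobenius_norm_ge0.
Qed.

(** Each entry of [A *m X] is a row of [A] against a column of [X], so Cauchy-Schwarz applies
    entrywise. This is what bounds the supremum defining [spectral_norm]. *)
Lemma opnorm_le_frobenius (R : realType) n (A : 'M[R]_n) :
  opnorm_le (frobenius_norm A) A.
Proof.
move=> p X; rewrite -(@ler_pXn2r _ 2) ?nnegrE ?mulr_ge0 ?frobenius_norm_ge0 //.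
rewrite exprMn !sqr_frobenius_norm dotmE (dotmE A A) mulr_suml.
apply: ler_sum => i _; rewrite (dotm_col X X) mulr_sumr.
apply: ler_sum => j _.
have := dotm_CauchySchwarz (row i A)^T (col j X).
rewrite dotm_tr -expr2.
have -> : dotm (row i A)^T (col j X) = (A *m X) i j.
  by rewrite dotmE mxE; apply: eq_bigr => k _; rewrite big_ord1 !mxE.
suff -> : dotm (row i A) (row i A) = \sum_j A i j * A i j by [].
by rewrite dotmE big_ord1; apply: eq_bigr => k _; rewrite !mxE.
Qed.

Local Open Scope classical_set_scope.

Lemma has_sup_spectral_norm (R : realType) n (A : 'M[R]_n) :
  has_sup [set frobenius_norm (A *m x) |
           x in [set x : 'cV[R]_n | frobenius_norm x <= 1]].
Proof.
split.
  by exists (frobenius_norm (A *m (0 : 'cV[R]_n))), 0; rewrite //= frobenius_norm0.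
exists (frobenius_norm A) => _ [x /= x1 <-].
apply: le_trans (opnorm_le_frobenius _ _) _.
by rewrite ler_piMr ?frobenius_norm_ge0.
Qed.

Lemma spectral_norm_ge0 (R : realType) n (A : 'M[R]_n) : 0 <= spectral_norm A.
Proof.
have [[_ [x xP _]] ub] := has_sup_spectral_norm A.
apply: le_trans (frobenius_norm_ge0 (A *m x)) _.
by apply: ub_le_sup => //; exists x.
Qed.

Lemma opnorm_le_spectral (R : realType) n (A : 'M[R]_n) :
  opnorm_le (spectral_norm A) A.
Proof.
apply: opnorm_le_cV; first exact: spectral_norm_ge0.
move=> x; have [->|x0] := eqVneq x 0.
  by rewrite mulmx0 !frobenius_norm0 mulr0.
have x_gt0 : 0 < frobenius_norm x.
  by rewrite lt_def frobenius_norm_eq0 x0 frobenius_norm_ge0.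
rewrite -ler_pdivrMr // mulrC.
have -> : (frobenius_norm x)^-1 * frobenius_norm (A *m x) =
    frobenius_norm (A *m ((frobenius_norm x)^-1 *: x)).
  by rewrite -scalemxAr frobenius_normZ ger0_norm // invr_ge0 ltW.
apply: ub_le_sup; first by have [] := has_sup_spectral_norm A.
exists ((frobenius_norm x)^-1 *: x) => //=.
by rewrite frobenius_normZ ger0_norm ?invr_ge0 ?(ltW x_gt0)// mulVf // gt_eqF.
Qed.

(** * The Loewner order and the smallest singular value *)

(** The Loewner inequality [a I <= A], tested on blocks of columns so that [X] may itself be a
    square matrix such as the residual. *)
Definition quad_ge (R : realType) (n : nat) (a : R) (A : 'M[R]_n) : Prop :=
  forall p (X : 'M[R]_(n, p)), a * dotm X X <= dotm X (A *m X).

Definition quad_le (R : realType) (n : nat) (b : R) (A : 'M[R]_n) : Prop :=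
  forall p (X : 'M[R]_(n, p)), dotm X (A *m X) <= b * dotm X X.

Lemma quad_ge_cV (R : realType) n (a : R) (A : 'M[R]_n) :
  (forall x : 'cV[R]_n, a * dotm x x <= dotm x (A *m x)) -> quad_ge a A.
Proof.
move=> HA p X; rewrite dotm_col (dotm_col X (A *m X)) mulr_sumr.
by apply: ler_sum => j _; rewrite !colE -mulmxA.
Qed.

Lemma dotm_sym (R : realType) n p (A : 'M[R]_n) (X Y : 'M[R]_(n, p)) :
  A^T = A -> dotm X (A *m Y) = dotm (A *m X) Y.
Proof. by move=> As; rewrite dotm_mull As. Qed.

(* [b (b A - A^2) = A (b - A) A + (b - A) A (b - A)] *)
Lemma quad_sqr_le (R : realType) n (b : R) (A : 'M[R]_n) p (X : 'M[R]_(n, p)) :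
  0 < b -> A^T = A -> quad_ge 0 A -> quad_le b A ->
  dotm (A *m X) (A *m X) <= b * dotm X (A *m X).
Proof.
move=> b0 As A0 Ab; rewrite -(ler_pM2l b0).
have := Ab _ (A *m X); have := A0 _ (b *: X - A *m X).
rewrite mulmxBr -scalemxAr !dotm_lin mul0r.
rewrite (dotm_sym X (A *m X) As).
lra.
Qed.

Lemma quad_opnorm (R : realType) n (b : R) (A : 'M[R]_n) :
  0 < b -> A^T = A -> quad_ge 0 A -> quad_le b A -> opnorm_le b A.
Proof.
move=> b0 As A0 Ab p X; have b0' := ltW b0.
rewrite -(@ler_pXn2r _ 2) ?nnegrE ?mulr_ge0 ?frobenius_norm_ge0 //.
rewrite exprMn !sqr_frobenius_norm.
apply: le_trans (quad_sqr_le _ b0 As A0 Ab) _.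
by rewrite expr2 -mulrA ler_wpM2l.
Qed.

Lemma opnorm_quad_le (R : realType) n (a : R) (A : 'M[R]_n) :
  opnorm_le a A -> quad_le a A.
Proof. by move=> HA p X; apply: le_trans (ler_norm _) (opnorm_le_quad _ HA). Qed.

Lemma opnorm_quad_ge (R : realType) n (a : R) (A : 'M[R]_n) :
  opnorm_le a A -> quad_ge (- a) A.
Proof.
by move=> HA p X; have := opnorm_le_quad X HA; rewrite ler_norml mulNr => /andP[].
Qed.

Lemma quad_geD (R : realType) n (a b : R) (A B : 'M[R]_n) :
  quad_ge a A -> quad_ge b B -> quad_ge (a + b) (A + B).
Proof. by move=> HA HB p X; rewrite mulmxDl dotmDr mulrDl lerD. Qed.

Lemma quad_leD (R : realType) n (a b : R) (A B : 'M[R]_n) :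
  quad_le a A -> quad_le b B -> quad_le (a + b) (A + B).
Proof. by move=> HA HB p X; rewrite mulmxDl dotmDr mulrDl lerD. Qed.

Lemma quad_ge_weaken (R : realType) n (a b : R) (A : 'M[R]_n) :
  a <= b -> quad_ge b A -> quad_ge a A.
Proof.
by move=> ab HA p X; apply: le_trans (HA p X); rewrite ler_wpM2r ?dotm_ge0.
Qed.

Lemma quad_le_weaken (R : realType) n (a b : R) (A : 'M[R]_n) :
  a <= b -> quad_le a A -> quad_le b A.
Proof.
by move=> ab HA p X; apply: le_trans (HA p X) _; rewrite ler_wpM2r ?dotm_ge0.
Qed.

Lemma quad_ge_le (R : realType) n (a b : R) (A : 'M[R]_n) :
  (0 < n)%N -> quad_ge a A -> quad_le b A -> a <= b.
Proof.
case: n A => // n A _ HA HB.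
have x0 : (delta_mx 0 0 : 'cV[R]_n.+1) != 0.
  by apply/eqP => /matrixP/(_ 0 0); rewrite !mxE /= => /eqP; rewrite oner_eq0.
by rewrite -(ler_pM2r (dotm_gt0 x0)); apply: le_trans (HA _ _) (HB _ _).
Qed.

Lemma mx11_dotm (R : realType) n (A : 'M[R]_n) (x : 'cV[R]_n) :
  (x^T *m A *m x) 0 0 = dotm x (A *m x).
Proof. by rewrite /dotm mulmxA trace_mx11. Qed.

Lemma quad_ge_posdef (R : realType) n (a : R) (A : 'M[R]_n) :
  0 < a -> A^T = A -> quad_ge a A -> posdef A.
Proof.
move=> a0 As HA; split => // x x0; rewrite mx11_dotm.
by apply: lt_le_trans (HA _ x); rewrite mulr_gt0 ?dotm_gt0.
Qed.

Lemma eigenvalue_unitmx (R : realType) n (A : 'M[R]_n) (a : R) :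
  eigenvalue A a = (A - a%:M \notin unitmx).
Proof. by rewrite /eigenvalue /eigenspace kermx_eq0 row_free_unit. Qed.

(* The infimum of the Rayleigh quotient is an eigenvalue: if [P = A - inf] were
   invertible, [|x| <= |P^-1| |P x|] and [|P x|^2 <= |P| <x, P x>] would keep
   [<x, P x>] away from [0] on the unit sphere. *)
Lemma min_eigenvalue (R : realType) n (A : 'M[R]_n) :
  (0 < n)%N -> A^T = A -> quad_ge 0 A ->
  exists2 l, quad_ge l A & eigenvalue A l.
Proof.
case: n A => // n A _ As A0.
pose S := [set dotm x (A *m x) | x in [set x : 'cV[R]_n.+1 | dotm x x = 1]].
have SnE : S !=set0.
  pose e : 'cV[R]_n.+1 := delta_mx 0 0; exists (dotm e (A *m e)), e => //=.
  rewrite dotmE (bigD1 0) //= big_ord1 big1 => [|i /negPf i0];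
      rewrite ?big_ord1 !mxE.
    by rewrite !eqxx mulr1 addr0.
  by rewrite i0 mulr0.
have Slb : has_lbound S.
  by exists 0 => _ [x _ <-]; apply: le_trans (A0 _ x); rewrite mul0r.
pose l := inf S.
have Al : quad_ge l A.
  apply: quad_ge_cV => x; have [->|x0] := eqVneq x 0.
    by rewrite mulmx0 /dotm !mulmx0 !mxtrace0 mulr0.
  have xx := dotm_gt0 x0; set s := Num.sqrt (dotm x x).
  have s2 : s ^+ 2 = dotm x x by rewrite sqr_sqrtr ?ltW.
  have s0 : s != 0 by rewrite sqrtr_eq0 -ltNge.
  have -> : dotm x (A *m x) = dotm (s^-1 *: x) (A *m (s^-1 *: x)) * dotm x x.
    by rewrite -scalemxAr !dotm_lin -s2; field.
  rewrite ler_wpM2r ?dotm_ge0 //; apply: (ge_inf Slb); exists (s^-1 *: x) => //=.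
  by rewrite !dotm_lin -s2; field.
exists l => //; rewrite eigenvalue_unitmx; apply/negP => Pu.
set P := A - l%:M in Pu.
have Ps : P^T = P by rewrite /P raddfB /= As tr_scalar_mx.
have PE p (X : 'M[R]_(n.+1, p)) :
    dotm X (P *m X) = dotm X (A *m X) - l * dotm X X.
  by rewrite mulmxBl mul_scalar_mx !dotm_lin.
have P0 : quad_ge 0 P by move=> p X; rewrite mul0r PE subr_ge0.
(* Adding [1] makes [k], and [v] below, positive at no cost. *)
set k := spectral_norm P + 1.
have k0 : 0 < k by rewrite ltr_wpDl ?spectral_norm_ge0.
have Pk : quad_le k P.
  apply: quad_le_weaken (opnorm_quad_le (@opnorm_le_spectral _ _ P)).
  by rewrite lerDl.
set v := spectral_norm (invmx P) + 1.
have v0 : 0 < v by rewrite ltr_wpDl ?spectral_norm_ge0.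
(* On the unit sphere [1 <= v^2 |P x|^2 <= v^2 k <x, P x>], so [S] would have a lower bound above
   its infimum. *)
have : l + (v ^+ 2 * k)^-1 <= l.
  apply: lb_le_inf => // _ [x /= x1 <-].
  rewrite -subr_ge0 opprD addrA.
  have -> : dotm x (A *m x) - l = dotm x (P *m x) by rewrite PE x1 mulr1.
  rewrite subr_ge0 invfM mulrC -ler_pdivlMl ?invr_gt0 // invrK.
  apply: le_trans (quad_sqr_le x k0 Ps P0 Pk).
  rewrite -[leLHS]mulr1 -x1 ler_pdivrMl ?exprn_gt0 //.
  rewrite -!sqr_frobenius_norm -exprMn ler_pXn2r ?nnegrE ?mulr_ge0 ?(ltW v0)
    ?frobenius_norm_ge0 //.
  rewrite -{1}(mulKmx Pu x); apply: le_trans (opnorm_le_spectral _ _) _.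
  by rewrite ler_wpM2r ?frobenius_norm_ge0 // lerDl.
by apply/negP; rewrite -ltNge ltrDl invr_gt0 mulr_gt0 ?exprn_gt0.
Qed.

(** The least eigenvalue [l] is a singular value because [A^T A = A^2]. It is the least one: if [y]
    belongs to the singular value [s], then [l |y|^2 <= <y, A y> <= |y| |A y| = s |y|^2]. *)
Lemma sigma_min_posdef (R : realType) n (A : 'M[R]_n) : (0 < n)%N -> posdef A ->
  0 < sigma_min A /\ quad_ge (sigma_min A) A.
Proof.
move=> n0 [As Apos].
have A0 : quad_ge 0 A.
  apply: quad_ge_cV => x; rewrite mul0r; have [->|x0] := eqVneq x 0.
    by rewrite mulmx0 /dotm mulmx0 mxtrace0.
  by rewrite -mx11_dotm ltW ?Apos.
have [l Al /eigenvalueP[v vA v0]] := min_eigenvalue n0 As A0.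
have w0 : v^T != 0 by apply: contra v0 => /eqP E; rewrite -(trmxK v) E trmx0.
have wA : A *m v^T = l *: v^T by rewrite -{1}As -trmx_mul vA linearZ.
have l0 : 0 < l.
  by rewrite -(pmulr_lgt0 _ (dotm_gt0 w0)) -dotmZr -wA -mx11_dotm Apos.
have Sl : singular_value A l.
  split; first exact: ltW.
  by apply/eigenvalueP; exists v; rewrite // mulmxA As vA -scalemxAl vA scalerA expr2.
have Slb : lbound (singular_value A) l.
  move=> s [s0 /eigenvalueP[x xA x0]].
  have y0 : x^T != 0 by apply: contra x0 => /eqP E; rewrite -(trmxK x) E trmx0.
  have yA : dotm (A *m x^T) (A *m x^T) = s ^+ 2 * dotm x^T x^T.
    rewrite dotm_mull -dotmZr; congr dotm.
    have -> : s ^+ 2 *: x^T = (x *m (A^T *m A))^T by rewrite xA linearZ.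
    by rewrite !trmx_mul trmxK mulmxA.
  have := Al _ x^T; have := ler_dotm x^T (A *m x^T).
  rewrite frobenius_normE (frobenius_normE (A *m _)) yA sqrtrM ?sqr_ge0 //.
  rewrite sqrtr_sqr ger0_norm // mulrCA -expr2 sqr_sqrtr ?dotm_ge0 //.
  by move=> H1 H2; rewrite -(ler_pM2r (dotm_gt0 y0)) (le_trans H2 H1).
suff -> : sigma_min A = l by [].
apply/eqP; rewrite eq_le; apply/andP; split; last by apply: lb_le_inf => //; exists l.
by apply: ge_inf => //; exists l.
Qed.

(** * One gradient step *)

(** The step is [U - 2 eta U^3 + eta (M U + U M)]. Symmetry reduces its quadratic form to a few
    numbers, which turns the two Loewner bounds below into inequalities between reals. *)
Lemma dotm_gd_step (R : realType) n (M U : 'M[R]_n) eta p (X : 'M[R]_(n, p)) :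
  M^T = M -> U^T = U ->
  dotm X (sqrt_gd_step M eta U *m X) =
    dotm X (U *m X) - 2 * eta * dotm (U *m X) (U *m (U *m X))
    + 2 * eta * dotm (M *m X) (U *m X).
Proof.
move=> Ms Us; rewrite /sqrt_gd_step.
rewrite !(mulmxBl, mulmxBr) -!scalemxAl !(mulmxBl, mulmxBr) -!mulmxA !dotm_lin.
rewrite !(dotm_sym X _ Us) !(dotm_sym X _ Ms) (dotmC (U *m X) (M *m X)).
ring.
Qed.

(* With [P = B - U], [f(B) - f(U)] for [f(s) = s - 2 eta s^3] is
   [(1 - 6 eta B^2) P + 2 eta (2 B P^2 + P U P)]. *)
Lemma gd_step_quad_le (R : realType) n (M U : 'M[R]_n) (eta B L : R) :
  M^T = M -> U^T = U -> 0 <= eta -> 0 < B -> 0 <= L ->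
  quad_ge 0 U -> quad_le B U -> opnorm_le L M ->
  3 * L <= B ^+ 2 -> 6 * (eta * B ^+ 2) <= 1 ->
  quad_le (B - 4 / 3 * (eta * B ^+ 3)) (sqrt_gd_step M eta U).
Proof.
move=> Ms Us eta0 B0 L0 U0 UB ML LB etaB p X.
have UBop := quad_opnorm B0 Us U0 UB.
rewrite dotm_gd_step //.
have w : dotm (M *m X) (U *m X) <= L * B * dotm X X.
  apply: le_trans (ler_dotm _ _) _.
  rewrite -sqr_frobenius_norm expr2 mulrACA.
  by rewrite ler_pM ?frobenius_norm_ge0 ?ML ?UBop.
have P1 := UB _ X.
have P2 := dotm_ge0 (B *: X - U *m X).
have P3 := U0 _ (B *: X - U *m X).
move: P2 P3; rewrite mulmxBr -scalemxAr mul0r !dotm_lin.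
rewrite (dotm_sym X (U *m X) Us) (dotmC (U *m X) X).
move: P1 w (dotm_ge0 X).
move: (dotm X X) (dotm X (U *m X)) (dotm (U *m X) (U *m X))
  (dotm (U *m X) (U *m (U *m X))) (dotm (M *m X) (U *m X)) => a0 a1 a2 a3 w.
move=> P1 wle a0_ge0 P2 P3.
have H1 : 0 <= (1 - 6 * (eta * B ^+ 2)) * (B * a0 - a1).
  by rewrite mulr_ge0 ?subr_ge0.
have H2 : 0 <= eta * B * (B ^+ 2 * a0 - 2 * B * a1 + a2).
  rewrite mulr_ge0 ?mulr_ge0 ?(ltW B0) //; apply: le_trans P2 _.
  by rewrite le_eqVlt; apply/orP; left; apply/eqP; ring.
have H3 : 0 <= eta * (B ^+ 2 * a1 - 2 * B * a2 + a3).
  rewrite mulr_ge0 //; apply: le_trans P3 _.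
  by rewrite le_eqVlt; apply/orP; left; apply/eqP; ring.
(* The [M] terms add at most [2 eta L B <= 2/3 eta B^3] to [f(B) = B - 2 eta B^3], whence the
   constant [4 / 3]. *)
have H4 : eta * w <= eta * (L * B * a0) by rewrite ler_wpM2l.
have H5 : eta * B * a0 * (3 * L) <= eta * B * a0 * B ^+ 2.
  by rewrite ler_wpM2l // !mulr_ge0 // ltW.
lra.
Qed.

(* [U - 2 eta U^3] is bounded below by monotonicity on one half of [U]; the
   other half absorbs the indefinite [M U + U M] by completing the square
   [(1 + 2 eta M) (U / 2) (1 + 2 eta M)]. *)
Lemma gd_step_quad_ge (R : realType) n (M U : 'M[R]_n) (eta B L u m : R) :
  M^T = M -> U^T = U -> 0 <= eta -> 0 < u -> u <= B -> 0 < L -> 0 <= m ->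
  quad_ge u U -> quad_le B U -> quad_ge m M -> quad_le L M ->
  28 * (eta * B ^+ 2) <= 1 -> eta * (B * L) <= u ->
  quad_ge (u - 2 * (eta * u ^+ 3) + 2 * (eta * ((u - eta * (B * L)) * m)))
    (sqrt_gd_step M eta U).
Proof.
move=> Ms Us eta0 u0 uB L0 m0 Uu UB Mm ML etaB etaBL p X.
rewrite dotm_gd_step //; have B0 := lt_le_trans u0 uB.
have M0 : quad_ge 0 M by apply: quad_ge_weaken Mm.
pose P := U - u%:M.
have Ps : P^T = P by rewrite /P raddfB /= Us tr_scalar_mx.
have PE q (Y : 'M[R]_(n, q)) : P *m Y = U *m Y - u *: Y.
  by rewrite mulmxBl mul_scalar_mx.
have P0 : quad_ge 0 P.
  by move=> q Y; rewrite mul0r PE !dotm_lin subr_ge0.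
have PB : quad_le B P.
  move=> q Y; rewrite PE !dotm_lin.
  have := UB _ Y; have := mulr_ge0 (ltW u0) (dotm_ge0 Y); lra.
have p1 := P0 _ X; have p2 := quad_sqr_le X B0 Ps P0 PB; have p3 := PB _ (P *m X).
pose Y := X + (2 * eta) *: (M *m X).
have y1 := Uu _ Y.
have q1 := quad_sqr_le X L0 Ms M0 ML.
have q2 := UB _ (M *m X).
have q3 := Mm _ X.
move: p1 p2 p3 y1; rewrite /Y !PE !(mulmxBr, mulmxDr, mulmxN) -!scalemxAr mul0r.
rewrite !dotm_lin !(dotm_sym X _ Us) !(dotmC (U *m X) X).
rewrite (dotmC (U *m X) (M *m X)) !(dotmC (M *m X) X).
move: q1 q2 q3 (dotm_ge0 (M *m X)).
move: (dotm X X) (dotm X (U *m X)) (dotm (U *m X) (U *m X))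
  (dotm (U *m X) (U *m (U *m X))) (dotm (M *m X) (U *m X)) (dotm X (M *m X))
  (dotm (M *m X) (M *m X)) (dotm (M *m X) (U *m (M *m X))).
move=> a0 a1 a2 a3 w q mm mum q1 q2 q3 mm0 p1 p2 p3 y1.
set s := a1 - u * a0 in p1 *.
have [u0' B0'] := (ltW u0, ltW B0).
(* The half with the cubic term: [U^3 - u^3 = 3 u^2 P + 3 u P^2 + P^3] is at most [7 B^2 P], and
   half of [P] absorbs [2 eta] times this when [28 eta B^2 <= 1]. *)
have r1 : a2 - 2 * u * a1 + u ^+ 2 * a0 <= B * s by move: p2; rewrite /s; lra.
have r2 := ler_wpM2l u0' r1; have r3 := ler_wpM2l B0' r1.
have r4 : a3 - u ^+ 3 * a0 <= (3 * u ^+ 2 + 3 * (u * B) + B ^+ 2) * s.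
  by move: p3 r2 r3; rewrite /s; lra.
have r5 : (3 * u ^+ 2 + 3 * (u * B) + B ^+ 2) * s <= 7 * B ^+ 2 * s.
  rewrite ler_wpM2r //; have := ler_wpM2l u0' uB; have := ler_wpM2r B0' uB; lra.
have r6 := ler_wpM2l eta0 (le_trans r4 r5).
have r7 := ler_wpM2r p1 etaB.
(* The square adds an extra [2 eta^2 M U M], at most [2 eta^2 B L M]; this lowers the coefficient
   [u] of [2 eta M] to [u - eta B L]. *)
have r8 := ler_wpM2l B0' q1.
have r9 := ler_wpM2l (sqr_ge0 eta) (le_trans q2 r8).
have r10 : 0 <= eta * (u - eta * (B * L)) * (q - m * a0).
  by rewrite !mulr_ge0 ?subr_ge0.
have r11 : 0 <= eta ^+ 2 * u * mm by rewrite !mulr_ge0 ?sqr_ge0.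
move: y1 r6 r7 r9 r10 r11; rewrite /s; lra.
Qed.

(** Here [U *m U - E] plays [M], and the new residual is [E - H]. As
    [<E, H> = eta |G|^2 - eta^2 <E, G^2>], it suffices that
    [2 eta^2 |<E, G^2>| + |H|^2 <= eta |G|^2]. *)
Lemma gd_step_contraction (R : realType) n (U E : 'M[R]_n) (eta b e u : R)
    (G := E *m U + U *m E) :
  U^T = U -> E^T = E -> 0 <= eta -> 0 <= b -> 0 <= e -> 0 <= u ->
  opnorm_le b U -> opnorm_le e E -> quad_ge u U ->
  3 * e <= 4 * b ^+ 2 -> 10 * (eta * b ^+ 2) <= 1 ->
  dotm ((U - eta *: G) *m (U - eta *: G) - (U *m U - E))
       ((U - eta *: G) *m (U - eta *: G) - (U *m U - E))
    <= (1 - 4 * (eta * u ^+ 2)) * dotm E E.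
Proof.
move=> Us Es eta0 b0 e0 u0 Ub Ee Uu eb etab.
have Gs : G^T = G by rewrite /G raddfD /= !trmx_mul Us Es addrC.
pose H := eta *: (U *m G + G *m U) - eta ^+ 2 *: (G *m G).
have -> : (U - eta *: G) *m (U - eta *: G) - (U *m U - E) = E - H.
  rewrite /H !(mulmxBl, mulmxBr) -!scalemxAl -!scalemxAr.
  move: (U *m U) (U *m G) (G *m U) (G *m G) => UU UG GU GG.
  by apply/matrixP => i j; rewrite !mxE; ring.
have EK : dotm E (U *m G + G *m U) = dotm G G.
  rewrite dotmDr dotm_sym // -{2}Us -dotm_mulr -dotmDl addrC.
  by [].
have EGG : `|dotm E (G *m G)| <= e * dotm G G.
  by rewrite -{2}Gs -dotm_mulr dotmC opnorm_le_quad.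
have Gop : opnorm_le (2 * (b * e)) G.
  have -> : 2 * (b * e) = e * b + b * e by ring.
  by apply: opnorm_leD; apply: opnorm_leM.
have NH : frobenius_norm H <=
    (eta * (2 * b) + eta ^+ 2 * (2 * (b * e))) * frobenius_norm G.
  apply: le_trans (ler_frobenius_normB _ _) _.
  rewrite mulrDl !frobenius_normZ !ger0_norm ?sqr_ge0 // -!mulrA lerD //.
    rewrite ler_wpM2l // mulrDl mul1r; apply: le_trans (ler_frobenius_normD _ _) _.
    by rewrite lerD // opnorm_le_mulr.
  by do 2!rewrite ler_wpM2l //; apply: le_trans (Gop _ _) _; rewrite -!mulrA.
have HH : dotm H H <=
    (eta * (2 * b) + eta ^+ 2 * (2 * (b * e))) ^+ 2 * dotm G G.
  rewrite -!sqr_frobenius_norm -exprMn ler_pXn2r ?nnegrE ?frobenius_norm_ge0 //.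
  exact: le_trans (frobenius_norm_ge0 _) NH.
(* Both halves of [<E, G>] are at least [u |E|^2]; Cauchy-Schwarz then gives the claim after
   cancelling [|E|^2], hence the separate case [E = 0]. *)
have GE : 4 * u ^+ 2 * dotm E E <= dotm G G.
  have [->|E0] := eqVneq E 0.
    by rewrite /dotm !mulmx0 mxtrace0 mulr0 dotm_ge0.
  have uE : 2 * u * dotm E E <= dotm E G.
    have := Uu _ E; rewrite /G dotmDr -(dotm_tr E (E *m U)) trmx_mul Us Es; lra.
  rewrite -(ler_pM2l (dotm_gt0 E0)); apply: le_trans (dotm_CauchySchwarz E G).
  have : (2 * u * dotm E E) ^+ 2 <= dotm E G ^+ 2.
    by rewrite ler_pXn2r ?nnegrE ?(le_trans _ uE) ?mulr_ge0 ?dotm_ge0.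
  lra.
have EH : dotm E H = eta * dotm G G - eta ^+ 2 * dotm E (G *m G).
  by rewrite /H dotmDr dotmNr !dotmZr EK.
clearbody H; rewrite !dotm_lin (dotmC H E) EH.
move: (dotm_ge0 G) EGG HH GE; move: (dotm G G) (dotm E E) (dotm H H) (dotm E (G *m G)).
move=> g ee hh egg g0 /ler_normlW EGG HH GE.
set h := eta * b ^+ 2 in etab.
have h0 : 0 <= h by rewrite mulr_ge0 ?sqr_ge0.
set k := eta * e.
have k0 : 0 <= k by rewrite mulr_ge0.
have kh : 3 * k <= 4 * h by have := ler_wpM2l eta0 eb; rewrite /k /h; lra.
have k1 : k <= 2 / 15 by lra.
(* The sufficient condition divided by [eta |G|^2]: [2 k] bounds the term in [<E, G^2>] and the rest
   bounds [|H|^2]. It holds since [h <= 1/10] and [k <= 2/15]. *)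
have c1 : 2 * k + 4 * h * (1 + k) ^+ 2 <= 1.
  have d1 : 0 <= 2 / 15 - k by lra.
  have := mulr_ge0 h0 (mulr_ge0 d1 k0); have := mulr_ge0 h0 d1; lra.
have c2 := ler_wpM2r (mulr_ge0 eta0 g0) c1.
have c3 := ler_wpM2l (sqr_ge0 eta) EGG.
have c4 := ler_wpM2l eta0 GE.
move: c2 c3 c4 HH; rewrite /h /k; lra.
Qed.

Lemma sqrt_gd_stepE (R : realType) n (M U : 'M[R]_n) (eta : R) :
  sqrt_gd_step M eta U = U - eta *: ((U *m U - M) *m U + U *m (U *m U - M)).
Proof. by rewrite /sqrt_gd_step scalerDr opprD addrA. Qed.

Lemma gd_step_sym (R : realType) n (M U : 'M[R]_n) (eta : R) :
  M^T = M -> U^T = U -> (sqrt_gd_step M eta U)^T = sqrt_gd_step M eta U.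
Proof.
move=> Ms Us; rewrite sqrt_gd_stepE.
have Es : (U *m U - M)^T = U *m U - M by rewrite raddfB /= trmx_mul Us Ms.
by rewrite raddfB /= linearZ raddfD /= !trmx_mul Us Es [X in eta *: X]addrC.
Qed.

Lemma gd_step_residual (R : realType) n (M U : 'M[R]_n) (eta B L u : R) :
  M^T = M -> U^T = U -> 0 <= eta -> 0 < B -> 0 <= L -> 0 <= u ->
  quad_ge u U -> quad_le B U -> opnorm_le L M ->
  3 * L <= B ^+ 2 -> 10 * (eta * B ^+ 2) <= 1 ->
  frobenius_norm (sqrt_gd_step M eta U *m sqrt_gd_step M eta U - M)
    <= expR (- (2 * eta * u ^+ 2)) * frobenius_norm (M - U *m U).
Proof.
move=> Ms Us eta0 B0 L0 u0 Uu UB ML LB etaB; have B0' := ltW B0.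
have Uop : opnorm_le B U by apply: quad_opnorm => //; exact: quad_ge_weaken Uu.
set E := U *m U - M.
have Es : E^T = E by rewrite /E raddfB /= trmx_mul Us Ms.
have Eop : opnorm_le (B * B + L) E.
  by apply: opnorm_leD; [exact: opnorm_leM|exact: opnorm_leN].
have eB : 3 * (B * B + L) <= 4 * B ^+ 2 by lra.
have e0 : 0 <= B * B + L by rewrite addr_ge0 ?mulr_ge0.
have := gd_step_contraction Us Es eta0 B0' e0 u0 Uop Eop Uu eB etaB.
rewrite -sqrt_gd_stepE.
have -> : U *m U - E = M by rewrite /E subKr.
have -> : M - U *m U = - E by rewrite opprB.
rewrite frobenius_normN -!sqr_frobenius_norm => H.
rewrite -(@ler_pXn2r _ 2) ?nnegrE ?mulr_ge0 ?expR_ge0 ?frobenius_norm_ge0 //.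
apply: le_trans H _; rewrite exprMn ler_wpM2r ?sqr_ge0 //.
(* The squared factor satisfies [1 - 4 eta u^2 <= exp(- 4 eta u^2)]; the square root halves the
   exponent. *)
rewrite -expRM_natl; apply: le_trans (expR_ge1Dx _).
by rewrite le_eqVlt; apply/orP; left; apply/eqP; ring.
Qed.

(** Expanding around the perturbed iterate, [V^2 = W^2 - W D - D W + D^2]: the cross terms cost
    [2 B |D|], and the quadratic one [d |D| <= 2 B |D|]. *)
Lemma gd_perturb_residual (R : realType) n (M V D : 'M[R]_n) (B d : R) :
  V^T = V -> D^T = D -> opnorm_le B (V + D) -> opnorm_le d D -> d <= 2 * B ->
  frobenius_norm (M - (V + D) *m (V + D))
    <= frobenius_norm (V *m V - M) + 4 * B * frobenius_norm D.
Proof.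
move=> Vs Ds WB Dd dB; set W := V + D in WB *.
have Ws : W^T = W by rewrite /W raddfD /= Vs Ds.
have -> : M - W *m W = - (V *m V - M) - (W *m D + D *m W - D *m D).
  rewrite /W !(mulmxDl, mulmxDr).
  move: (V *m V) (V *m D) (D *m V) (D *m D) => VV VD DV DD.
  by apply/matrixP => i j; rewrite !mxE; ring.
apply: le_trans (ler_frobenius_normB _ _) _; rewrite frobenius_normN lerD2l.
apply: le_trans (ler_frobenius_normB _ _) _.
have := ler_frobenius_normD (W *m D) (D *m W).
have := WB _ D; have := opnorm_le_mulr D Ws WB; have := Dd _ D.
have := ler_wpM2r (frobenius_norm_ge0 D) dB.
lra.
Qed.

(** The floor is [b / 2] rather than [b] to leave room for errors: there the loss [2 eta u^3] is at
    most [eta m b / 4], while [M] contributes at least [24/25 eta m b]. At the top, the margin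
    [4/3 eta B^3] exceeds [d <= eta B^3 / 900]. *)
Lemma gd_step_invariant (R : realType) n (M U D : 'M[R]_n) (eta B L m b d : R) :
  M^T = M -> U^T = U -> D^T = D -> 0 < eta -> 0 < b -> b <= B -> b ^+ 2 <= m ->
  m <= L -> 3 * L <= B ^+ 2 -> 28 * (eta * B ^+ 2) <= 1 ->
  50 * (eta * (B * L)) <= b ->
  quad_ge m M -> opnorm_le L M -> opnorm_le d D -> 300 * d <= eta * m * b ->
  quad_ge (b / 2) U -> quad_le B U ->
  let W := sqrt_gd_step M eta U + D in
  [/\ quad_ge (b / 2) W, quad_le B W &
      frobenius_norm (M - W *m W) <=
        expR (- (1 / 2 * eta * b ^+ 2)) * frobenius_norm (M - U *m U)
        + 4 * B * frobenius_norm D].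
Proof.
move=> Ms Us Ds eta_gt0 b0 bB bm mL LB etaB etaBL Mm ML Dd dle Uu UB W.
have eta0 := ltW eta_gt0; have B0 := lt_le_trans b0 bB.
have m0 : 0 < m by apply: lt_le_trans bm; rewrite exprn_gt0.
have L0 := lt_le_trans m0 mL.
have u0 : 0 < b / 2 by rewrite divr_gt0.
have etaB0 : 0 <= eta * B ^+ 2 by rewrite mulr_ge0 ?sqr_ge0.
have Vs := gd_step_sym eta Ms Us.
have Wu : quad_ge (b / 2) W.
  have etaBLu : eta * (B * L) <= b / 2 by move: etaBL b0; clear; lra.
  have uB : b / 2 <= B by move: bB b0; clear; lra.
  apply: quad_ge_weaken (quad_geD (gd_step_quad_ge Ms Us eta0 u0 uB L0 (ltW m0)
    Uu UB Mm (opnorm_quad_le ML) etaB etaBLu) (opnorm_quad_ge Dd)).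
  have eb0 : 0 <= eta * b by rewrite mulr_ge0 // ltW.
  have em0 : 0 <= eta * m by rewrite mulr_ge0 // ltW.
  have h1 := ler_wpM2l eb0 bm.
  have h2 := ler_wpM2l em0 etaBL.
  have h3 := mulr_ge0 em0 (ltW b0).
  move: h1 h2 h3 dle; clear; lra.
have dB : 900 * d <= eta * B ^+ 3.
  have h1 : m * b <= L * B by rewrite ler_pM // ltW.
  have h2 := ler_wpM2l eta0 h1.
  have h3 := ler_wpM2l (mulr_ge0 eta0 (ltW B0)) LB.
  by move: h2 h3 dle; clear; lra.
have U0 : quad_ge 0 U by apply: quad_ge_weaken Uu; exact: ltW.
have WB : quad_le B W.
  have etaB' : 6 * (eta * B ^+ 2) <= 1 by move: etaB etaB0; clear; lra.
  apply: quad_le_weaken (quad_leD (gd_step_quad_le Ms Us eta0 B0 (ltW L0) U0 UB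
    ML LB etaB') (opnorm_quad_le Dd)).
  have : 0 <= eta * B ^+ 3 by rewrite mulr_ge0 // exprn_ge0 // ltW.
  by move: dB; clear; lra.
split=> //.
have dB' : d <= 2 * B.
  by have := ler_wpM2r (ltW B0) etaB; move: dB B0; clear; lra.
have Ws : W^T = W by rewrite /W raddfD /= Vs Ds.
have Wop : opnorm_le B W.
  by apply: quad_opnorm => //; apply: quad_ge_weaken Wu; exact: ltW.
apply: le_trans (gd_perturb_residual M Vs Ds Wop Dd dB') _; rewrite lerD2r.
have etaB' : 10 * (eta * B ^+ 2) <= 1 by move: etaB etaB0; clear; lra.
apply: le_trans (gd_step_residual Ms Us eta0 B0 (ltW L0) (ltW u0) Uu UB ML LB
  etaB') _.
rewrite le_eqVlt; apply/orP; left; apply/eqP; congr (expR _ * _).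
by field.
Qed.

(** * The iteration *)

Lemma geometric_recursion (R : realType) (T : nat) (r K : R) (x d : nat -> R) :
  (forall t, (t.+1 < T)%N -> x t.+1 <= expR (- r) * x t + K * d t) ->
  forall t, (t < T)%N ->
    x t <= expR (- (r * t%:R)) * x 0%N
      + K * \sum_(0 <= s < t) expR (- (r * (t - s - 1)%:R)) * d s.
Proof.
move=> step; elim=> [|t IH] tT.
  by rewrite mulr0 oppr0 expR0 big_geq // mul1r mulr0 addr0.
have eS k : expR (- (r * k.+1%:R)) = expR (- r) * expR (- (r * k%:R)).
  by rewrite -expRD -natr1; congr expR; ring.
apply: le_trans (step _ tT) _; rewrite big_nat_recr //= subSnn subnn mulr0 oppr0.
rewrite expR0 mul1r mulrDr addrA lerD2r.
apply: le_trans (ler_wpM2l (expR_ge0 _) (IH (ltnW tT))) _.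
rewrite le_eqVlt; apply/orP; left; apply/eqP.
rewrite eS mulrDr mulrA; congr (_ + _).
rewrite mulrCA; congr (_ * _); rewrite mulr_sumr !big_mkord.
(* For [s < t] the truncated difference [t - s - 1] grows by exactly one when [t] does; the new term
   [s = t], split off above, has exponent [0]. *)
apply: eq_bigr => s _; rewrite mulrA -eS; congr (expR (- (r * _%:R)) * _).
by rewrite !subn1 /= subSn ?(ltnW (ltn_ord _)) //= prednK // subn_gt0.
Qed.

(* The errors must be symmetric for the iterates to be: if U t is symmetric
   then U t.+1 - (U t.+1)^T = Delta t - (Delta t)^T. The error of the last
   step affects no U t with t < T and is not constrained. *)
Theorem theorem3p4 (R : realType) :
  exists c chat : R, [/\ 0 < c, 0 < chat &
    forall (n : nat) (M U0 : 'M[R]_n) (eta : R) (T : nat)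
           (Delta U : nat -> 'M[R]_n),
      (0 < n)%N ->
      posdef M ->
      posdef U0 ->
      0 < eta ->
      eta < c / (alpha M U0 * beta M U0 ^+ 2) ->
      (1 <= T)%N ->
      (forall t : nat, (t < T)%N ->
         spectral_norm (Delta t) < 1 / 300 * eta * sigma_min M * beta M U0) ->
      (forall t : nat, (t.+1 < T)%N -> (Delta t)^T = Delta t) ->
      U 0%N = U0 ->
      (forall t : nat, (t < T)%N ->
         U t.+1 = sqrt_gd_step M eta (U t) + Delta t) ->
      forall t : nat, (t < T)%N ->
        posdef (U t) /\
        frobenius_norm (M - U t *m U t) <=
          expR (- (chat * eta * beta M U0 ^+ 2 * t%:R)) *
            frobenius_norm (M - U0 *m U0)
          + 4 * Num.max (spectral_norm U0) (Num.sqrt (3 * spectral_norm M)) *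
            \sum_(0 <= s < t)
              expR (- (chat * eta * beta M U0 ^+ 2 * (t - s - 1)%:R)) *
              frobenius_norm (Delta s)].
Proof.
(* The rate [1 / 2] is [2 eta u^2] at [u = beta / 2], divided by [eta beta^2]. The value [1 / 100]
   covers [28 * 3] in [etaB] and [50 * 2] in [etaBL]. *)
exists (1 / 100), (1 / 2); split; [lra|lra|].
move=> n M U0 eta T Delta U n0 Mpd U0pd eta0 etalt T1 Deltalt Deltas U0E Ustep.
have [m0 Mm] := sigma_min_posdef n0 Mpd.
have [s0 Us0] := sigma_min_posdef n0 U0pd.
have [[Ms _] [U0s _]] := (Mpd, U0pd).
have ML := @opnorm_le_spectral _ _ M; have UN := @opnorm_le_spectral _ _ U0.
have mL := quad_ge_le n0 Mm (opnorm_quad_le ML).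
have sN := quad_ge_le n0 Us0 (opnorm_quad_le UN).
set B := Num.max (spectral_norm U0) _.
move: etalt Deltalt; rewrite /alpha /beta.
set m := sigma_min M in m0 Mm mL *; set L := spectral_norm M in ML mL B *.
set N := spectral_norm U0 in UN sN B *; set s := sigma_min U0 in s0 Us0 sN *.
set a := Num.max N (Num.sqrt L); set b := Num.min s (Num.sqrt m).
move=> etalt Deltalt.
have L0 := lt_le_trans m0 mL; have N0 := lt_le_trans s0 sN.
have b0 : 0 < b by rewrite lt_min s0 sqrtr_gt0.
have bs : b <= s by rewrite ge_min lexx.
have bm : b ^+ 2 <= m.
  rewrite -(sqr_sqrtr (ltW m0)) ler_pXn2r ?nnegrE ?sqrtr_ge0 ?(ltW b0) //.
  by rewrite ge_min lexx orbT.
have Na : N <= a by rewrite le_max lexx.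
have a0 := lt_le_trans N0 Na; have a0' := ltW a0.
have La : L <= a ^+ 2.
  rewrite -(sqr_sqrtr (ltW L0)) ler_pXn2r ?nnegrE ?sqrtr_ge0 //.
  by rewrite le_max lexx orbT.
have ba : b <= a by rewrite (le_trans bs) // (le_trans sN).
have NB : N <= B by rewrite le_max lexx.
have B0 := lt_le_trans N0 NB; have B0' := ltW B0.
have L3 : 0 <= 3 * L by rewrite mulr_ge0 // ltW.
have LB : 3 * L <= B ^+ 2.
  rewrite -(sqr_sqrtr L3) ler_pXn2r ?nnegrE ?sqrtr_ge0 //.
  by rewrite le_max lexx orbT.
have Ba : B ^+ 2 <= 3 * a ^+ 2.
  rewrite /B; case: (leP N) => _; first by rewrite sqr_sqrtr //; lra.
  have : N ^+ 2 <= a ^+ 2 by rewrite ler_pXn2r ?nnegrE // ltW.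
  have := sqr_ge0 a; lra.
have B2a : B <= 2 * a.
  rewrite -(@ler_pXn2r _ 2) ?nnegrE ?mulr_ge0 //.
  have := sqr_ge0 a; lra.
have bB : b <= B by rewrite (le_trans bs) // (le_trans sN).
have eta0' := ltW eta0.
(* This is the step size hypothesis, since [alpha beta^2 = a^3 / b]. *)
have etaa3 : 100 * (eta * a ^+ 3) <= b.
  have ab0 : 0 < (a / b) ^+ 3 * b ^+ 2 by rewrite mulr_gt0 ?exprn_gt0 ?divr_gt0.
  move: etalt; rewrite ltr_pdivlMr // => /ltW etalt.
  have := ler_wpM2l (ltW b0) etalt.
  have -> : b * (eta * ((a / b) ^+ 3 * b ^+ 2)) = eta * a ^+ 3.
    by field; rewrite gt_eqF.
  lra.
have etaa2 : 100 * (eta * a ^+ 2) <= 1.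
  rewrite -(ler_pM2r a0) mul1r; apply: le_trans ba; apply: le_trans etaa3.
  by rewrite le_eqVlt; apply/orP; left; apply/eqP; ring.
have etaB : 28 * (eta * B ^+ 2) <= 1.
  have := ler_wpM2l eta0' Ba; have := mulr_ge0 eta0' (sqr_ge0 a).
  move: etaa2; clear; lra.
have etaBL : 50 * (eta * (B * L)) <= b.
  have : B * L <= 2 * a * a ^+ 2 by rewrite ler_pM // ltW.
  move=> /(ler_wpM2l eta0'); move: etaa3; clear; lra.
have D300 t : (t < T)%N -> 300 * spectral_norm (Delta t) <= eta * m * b.
  by move=> /Deltalt; clear; lra.
(* The bounds hold at [U0] because [b / 2 <= s] and [N <= B]; symmetry passes on because each error
   used before time [T - 1] is symmetric. *)
have inv t : (t < T)%N ->
    [/\ (U t)^T = U t, quad_ge (b / 2) (U t) & quad_le B (U t)].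
  elim: t => [|t IH] tT.
    rewrite U0E; split => //.
      by apply: quad_ge_weaken Us0; move: bs b0; clear; lra.
    exact: quad_le_weaken NB (opnorm_quad_le UN).
  have [Uts Utu UtB] := IH (ltnW tT); rewrite Ustep ?(ltnW tT) //.
  have [] := gd_step_invariant Ms Uts (Deltas _ tT) eta0 b0 bB bm mL LB etaB
    etaBL Mm ML (@opnorm_le_spectral _ _ _) (D300 _ (ltnW tT)) Utu UtB.
  by split; rewrite // raddfD /= gd_step_sym // Deltas.
move=> t tT; split.
  by have [Uts Utu _] := inv _ tT; apply: quad_ge_posdef Uts Utu; rewrite divr_gt0.
rewrite -U0E.
apply: (geometric_recursion (x := fun t => frobenius_norm (M - U t *m U t))
  (d := fun t => frobenius_norm (Delta t)) _ tT) => k kT.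
have [Uks Uku UkB] := inv _ (ltnW kT); rewrite Ustep ?(ltnW kT) //.
by have [] := gd_step_invariant Ms Uks (Deltas _ kT) eta0 b0 bB bm mL LB etaB
  etaBL Mm ML (@opnorm_le_spectral _ _ _) (D300 _ (ltnW kT)) Uku UkB.
Qed.
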